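(* Let $\overline{\mathcal{L}} \subseteq \mathcal{L}$ be any subset of storage locations. Then for every order $o \in \mathcal{O}$ and every SKU $s \in \mathcal{S}(o)$, the inequality $$\sum_{r \in \mathcal{R}_o} \delta_r(\overline{\mathcal{L}})\, \rho_{or} \;\geq\; \sum_{l \in \overline{\mathcal{L}}} \xi_{ls}$$ is valid for formulation (DW), i.e. it is satisfied by every feasible solution $(\xi,\rho)$ of (DW).
   Context: Data of the Storage Location Assignment and Picker Routing Problem: a finite set $\mathcal{L}$ of storage locations, each $l\in\mathcal{L}$ with a positive integer capacity $K_l$; a finite set $\mathcal{S}$ of SKUs; a finite set $\mathcal{O}$ of orders, each $o\in\mathcal{O}$ with a set $\mathcal{S}(o)\subseteq\mathcal{S}$ of SKUs; a set $\mathcal{F}\subseteq \mathcal{S}\times\mathcal{L}$ of fixed assignments. Storage nodes: $\mathcal{V}=\bigcup_{l\in\mathcal{L}}\{v_l^1,\dots,v_l^{K_l}\}$, $\mathcal{V}(l)=\{v_l^1,\dots,v_l^{K_l}\}$, $\mathcal{V}^0=\mathcal{V}\cup\{v_0\}$ with $v_0$ the drop-off point. Directed graph $\mathcal{G}=(\mathcal{V}^0,\mathcal{E})$ with $\mathcal{E}=\{(v_0,v_l^1):l\in\mathcal{L}\}\cup\{(v_l^i,v_0)\}\cup\{(v_l^i,v_{l'}^1): l,l'\in\mathcal{L}\}\cup\{(v_l^i,v_l^{i+1}): 1\le i\le K_l-1\}$ (indices $i$ ranging over $1,\dots,K_l$). For each order $o$, $\mathcal{R}_o$ is the finite set of routes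 for $o$: tours in $\mathcal{G}$ starting and ending at $v_0$, visiting each node at most once, and visiting exactly $|\mathcal{S}(o)|$ storage nodes. Each route $r\in\mathcal{R}_o$ has a cost $c_{or}\in\mathbb{R}$; $a_{or}^l$ denotes the number of nodes of $\mathcal{V}(l)$ visited by $r$ (so $a_{or}^l\in\{0,\dots,K_l\}$ and $\sum_{l}a_{or}^l=|\mathcal{S}(o)|$); for $\overline{\mathcal{L}}\subseteq\mathcal{L}$, $\delta_r(\overline{\mathcal{L}})=1$ if $a_{or}^l\ge 1$ for some $l\in\overline{\mathcal{L}}$, and $0$ otherwise. Formulation (DW): minimize $\sum_{o}\sum_{r\in\mathcal{R}_o}c_{or}\rho_{or}$ subject to $\sum_{s\in\mathcal{S}}\xi_{ls}\le K_l$ for all $l\in\mathcal{L}$; $\sum_{l\in\mathcal{L}}\xi_{ls}=1$ for all $s\in\mathcal{S}$; $\xi_{ls}=1$ for all $(s,l)\in\mathcal{F}$; $\sum_{r\in\mathcal{R}_o}\rho_{or}=1$ for all $o\in\mathcal{O}$; $\sum_{r\in\mathcal{R}_o}a_{or}^l\rho_{or}\ge\sum_{s\in\mathcal{S}(o)}\xi_{ls}$ for all $l\in\mathcal{L},o\in\mathcal{O}$; $\rho_{or}\in\{0,1\}$, $\xi_{ls}\in\{0,1\}$. *)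

(* Defs.v *)
From HB Require Import structures.
From mathcomp Require Import all_boot all_order all_algebra.
From mathcomp Require Import reals.

Set Implicit Arguments.
Unset Strict Implicit.
Unset Printing Implicit Defensive.

Import Order.TTheory GRing.Theory Num.Theory.
Local Open Scope ring_scope.

(* The node v_l^(i+1) is the pair of l and i : 'I_(K l): positions are counted
   from 0, so the entry node v_l^1 of a location has position 0. *)
Definition storage_node (L : finType) (K : L -> nat) : finType :=
  {l : L & 'I_(K l)}.

Definition node_loc (L : finType) (K : L -> nat) (v : storage_node K) : L :=
  tag v.

Definition node_pos (L : finType) (K : L -> nat) (v : storage_node K) : nat :=
  nat_of_ord (tagged v).

(* None is the drop-off point v_0. *)
Definition node (L : finType) (K : L -> nat) : finType :=
  option (storage_node K).

Definition edge (L : finType) (K : L -> nat) : rel (node K) :=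
  fun u v =>
    match u, v with
    | None, None => false
    | None, Some w => node_pos w == 0%N
    | Some _, None => true
    | Some w, Some w' =>
        (node_pos w' == 0%N) ||
        ((node_loc w' == node_loc w) && (node_pos w' == (node_pos w).+1))
    end.

(* A tour is given by the sequence p of its storage nodes, in visiting order;
   the closed walk is v_0, p, v_0.  Since (v_0, v_0) is not an edge, the tour
   that never leaves v_0 (the only one visiting no storage node) has to be
   admitted separately. *)
Definition is_tour (L : finType) (K : L -> nat) (p : seq (storage_node K)) :
    bool :=
  let c := None :: [seq Some v | v <- p] in
  uniq c && (nilp p || cycle (@edge L K) c).

Definition tour (L : finType) (K : L -> nat) (n : nat) : finType :=
  {p : n.-tuple (storage_node K) | is_tour p}.

Record slaprp (R : realType) := Slaprp {
  loc : finType;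
  capacity : loc -> nat;
  capacity_gt0 : forall l, (0 < capacity l)%N;
  sku : finType;
  ord : finType;
  skus : ord -> {set sku};
  fixed : {set sku * loc};
  cost : forall o : ord, tour capacity #|skus o| -> R
}.

Arguments capacity {R} _ _.
Arguments skus {R} _ _.
Arguments fixed {R} _.
Arguments cost {R} _ _ _.

Definition route (R : realType) (I : slaprp R) (o : ord I) : finType :=
  tour (capacity I) #|skus I o|.

Definition visits (R : realType) (I : slaprp R) (o : ord I) (r : route o)
    (l : loc I) : nat :=
  count (fun v => node_loc v == l) (val r).

Definition delta (R : realType) (I : slaprp R) (o : ord I) (r : route o)
    (A : {set loc I}) : nat :=
  if [exists l in A, (1 <= visits r l)%N] then 1%N else 0%N.

Definition dw_objective (R : realType) (I : slaprp R)
    (rho : forall o : ord I, route o -> R) : R :=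
  \sum_(o : ord I) \sum_(r : route o) cost I o r * rho o r.

Record dw_feasible (R : realType) (I : slaprp R)
    (xi : loc I -> sku I -> R) (rho : forall o : ord I, route o -> R) : Prop :=
  DwFeasible {
  dw_capacity : forall l, \sum_(s : sku I) xi l s <= (capacity I l)%:R;
  dw_assigned : forall s, \sum_(l : loc I) xi l s = 1;
  dw_fixed : forall s l, (s, l) \in fixed I -> xi l s = 1;
  dw_one_route : forall o, \sum_(r : route o) rho o r = 1;
  dw_linking : forall l o,
    \sum_(r : route o) (visits r l)%:R * rho o r
      >= \sum_(s in skus I o) xi l s;
  dw_rho_binary : forall o (r : route o), rho o r = 0 \/ rho o r = 1;
  dw_xi_binary : forall l s, xi l s = 0 \/ xi l s = 1
}.

(* Main.v *)
(** If [s] is stored in some [l0] of [Lbar], linking at [l0] forces a selected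
    route that visits [l0]; its term makes the left side at least 1, while
    the right side is at most 1 because [s] has a single location. *)
Require Import Defs.
From mathcomp Require Import all_boot all_order all_algebra.
From mathcomp Require Import reals.

Set Implicit Arguments.
Unset Strict Implicit.
Unset Printing Implicit Defensive.

Import Order.TTheory GRing.Theory Num.Theory.
Local Open Scope ring_scope.

Section Feasible.

Variables (R : realType) (I : slaprp R).
Variables (xi : loc I -> sku I -> R) (rho : forall o : ord I, route o -> R).
Hypothesis feas : dw_feasible xi rho.

Lemma dw_xi_ge0 l s : 0 <= xi l s.
Proof. by case: (dw_xi_binary feas l s) => ->. Qed.

Lemma dw_rho_ge0 o (r : route o) : 0 <= rho r.
Proof. by case: (dw_rho_binary feas r) => ->. Qed.

(** Otherwise every route is unselected or misses [l], so the left side of [dw_linking] at [l] and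
    [o] is 0, whereas its right side contains the term [xi l s], equal to 1, among nonnegative
    ones. *)
Lemma dw_selected_route_visits l o s :
  s \in skus I o -> xi l s = 1 ->
  exists2 r : route o, rho r = 1 & (0 < visits r l)%N.
Proof.
move=> so xi1.
have /existsP[r /andP[/eqP rho1 vis]] :
    [exists r : route o, (rho r == 1) && (0 < visits r l)%N]; last by exists r.
apply: contraT; rewrite negb_exists => /forallP none.
have := dw_linking feas l o.
rewrite [X in _ <= X]big1 => [|r _].
  rewrite (bigD1 s) //= xi1 leNgt ltr_pwDl ?ltr01 //.
  by apply: sumr_ge0 => s' _; apply: dw_xi_ge0.
(* Each product vanishes: either [rho r] is 0, or [r] is selected and [none] leaves no visit to
   [l]. *)
case: (dw_rho_binary feas r) => rhoE; first by rewrite rhoE mulr0.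
by have := none r; rewrite rhoE eqxx lt0n negbK => /eqP->; rewrite mul0r.
Qed.

(** Extending the sum to all locations adds only nonnegative terms and gives exactly 1. *)
Lemma dw_sum_xi_le1 (A : {set loc I}) s : \sum_(l in A) xi l s <= 1.
Proof.
rewrite -(dw_assigned feas s) [X in _ <= X](bigID (mem A)) /= lerDl.
by apply: sumr_ge0 => l _; apply: dw_xi_ge0.
Qed.

End Feasible.

Theorem theorem1 (R : realType) (I : slaprp R) (Lbar : {set loc I})
    (o : ord I) (s : sku I) (hs : s \in skus I o)
    (xi : loc I -> sku I -> R) (rho : forall o : ord I, route o -> R)
    (hfeas : dw_feasible xi rho) :
  \sum_(r : route o) (delta r Lbar)%:R * rho o r >= \sum_(l in Lbar) xi l s.
Proof.
have term_ge0 (r : route o) : 0 <= (delta r Lbar)%:R * rho o r.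
  by rewrite mulr_ge0 ?ler0n ?(dw_rho_ge0 hfeas).
have [/existsP[l0 /andP[l0A /eqP xi1]] | none] :=
    boolP [exists l in Lbar, xi l s == 1].
  have [r rho1 vis] := dw_selected_route_visits hfeas hs xi1.
  have delta1 : delta r Lbar = 1%N.
    by rewrite /delta ifT //; apply/existsP; exists l0; rewrite l0A.
  apply: (le_trans (dw_sum_xi_le1 hfeas Lbar s)).
  rewrite (bigD1 r) //= delta1 rho1 mulr1 lerDl.
  by apply: sumr_ge0 => r' _.
(* With [s] stored nowhere in [Lbar], binarity makes every [xi l s] on the right 0, and the left
   side is nonnegative. *)
rewrite big1 => [|l lA]; first by apply: sumr_ge0 => r _.
case: (dw_xi_binary hfeas l s) => // xi1.
by case/negP: none; apply/existsP; exists l; rewrite lA xi1 eqxx.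
Qed.
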